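(* Let $c\in\mathbb{R}$, $c\neq 0$. (i) If $c<0$ and $n=-cl$ for some integer $l\ge 1$, then for all $x\in\left[0,-\frac1c\right]$, $$S_{n-c,c}(x)\geq \bigl(1+2cx(1+cx)\bigr)S_{n,c}(x).$$ (ii) If $c>0$ and $n$ is a real number with $n>c$, then for all $x\in[0,+\infty)$ the reverse inequality holds: $$S_{n-c,c}(x)\leq \bigl(1+2cx(1+cx)\bigr)S_{n,c}(x).$$
   Context: For $\alpha\in\mathbb{R}$ and integers $k\ge 1$, $\binom{\alpha}{k}:=\frac{\alpha(\alpha-1)\cdots(\alpha-k+1)}{k!}$, and $\binom{\alpha}{0}:=1$. Let $c\neq 0$ be real, and let $I_c=\left[0,-\frac1c\right]$ if $c<0$, $I_c=[0,+\infty)$ if $c>0$. For a real number $m>0$ (with $m\in\{-cl: l=1,2,\dots\}$ if $c<0$), an integer $k\ge 0$ and $x\in I_c$, define $$p_{m,k}^{[c]}(x):=(-1)^{k}\binom{-\frac{m}{c}}{k}(cx)^{k}(1+cx)^{-\frac{m}{c}-k},$$ with the convention $0^0=1$; when $c<0$ and $k>-m/c$ the binomial coefficient vanishes and $p_{m,k}^{[c]}(x)$ is understood to be $0$. The index of coincidence is $$S_{m,c}(x):=\sum_{k=0}^{\infty}\left(p_{m,k}^{[c]}(x)\right)^{2},\quad x\in I_c.$$ *)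

(* Defs.v *)
From mathcomp Require Import all_boot all_order all_algebra.
From mathcomp Require Import all_classical all_reals all_analysis.

Set Implicit Arguments.
Unset Strict Implicit.
Unset Printing Implicit Defensive.

Import Order.TTheory GRing.Theory Num.Theory.
Import numFieldNormedType.Exports.

Local Open Scope ring_scope.

Definition gbinom (R : realType) (a : R) (k : nat) : R :=
  (\prod_(i < k) (a - i%:R)) / k`!%:R.

(* Both powers obey 0^0 = 1: the natural power [_ ^+ k] by computation, and the
   real power by [0 `^ 0 = 1]; moreover [0 `^ r = 0] for every [r != 0].  The
   base [1 + c * x] is nonnegative for [x] in I_c,
   that is [0, -1/c] if [c < 0] and [0, +oo[ if [c > 0].  When [c < 0], [m = - c * l]
   and [l < k], the factor [gbinom (- (m / c)) k] is 0, hence so is [pmk m c k x],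
   also at the endpoint x = -1/c, where the real power has base 0 and a negative
   exponent. *)
Definition pmk (R : realType) (m c : R) (k : nat) (x : R) : R :=
  (-1) ^+ k * gbinom (- (m / c)) k * (c * x) ^+ k
    * (1 + c * x) `^ (- (m / c) - k%:R).

(* The limit is that of the partial sums in R; for m > 0 and x in I_c the terms
   are eventually 0 (c < 0) or summable by the ratio test (c > 0). *)
Definition S_index (R : realType) (m c x : R) : R :=
  limn (series (fun k : nat => pmk m c k x ^+ 2)).

(* Main.v *)
Require Import Defs.
From mathcomp Require Import all_boot all_order all_algebra.
From mathcomp Require Import all_classical all_reals all_analysis.
From mathcomp Require Import ring lra.

Import Order.TTheory GRing.Theory Num.Theory.
Import numFieldNormedType.Exports.

Local Open Scope ring_scope.

(** In terms of [t = c * x] the factor of the theorem is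
    [1 + 2 * t * (1 + t) = (1 + t) ^+ 2 + t ^+ 2], and both parts follow from
    comparing the probabilities [pmk] of the parameters [n - c] and [n].

    For [c < 0] and [n = - c * l] these are binomial probabilities for [l.+1] and
    [l] trials with success probability [y = - t] ([pmk_binomial]).  One more
    trial convolves the distribution with [(1 - y, y)] ([binprobS]):
    [b (l+1) (k+1) = y * b l k + (1 - y) * b l (k+1)].  All quantities are
    nonnegative, so dropping the cross terms from the squares bounds the sum of
    squares below by [y ^+ 2 + (1 - y) ^+ 2] times the former one
    ([sum_sqr_binprobS]).

    For [c > 0] they are negative binomial probabilities with shape parameters
    [n / c - 1] and [n / c].  Lowering the shape by one lowers the coefficient
    [a (a+1) ... (a+k-1) / k!] and multiplies the power of [1 + t] by [1 + t], so
    that [pmk (n - c) c k x <= (1 + t) * pmk n c k x] term by term ([pmk_subr_le]);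
    squaring and summing gives the bound even with factor [(1 + t) ^+ 2].  Here
    the sums are infinite series, and passing to the limit needs their
    convergence, which comes from the ratio test ([is_cvg_series_sqr_pmk]). *)

(** * Series of real numbers *)

Lemma lim_series_finite (R : realType) (u : nat -> R) (N : nat) :
  (forall k, (N <= k)%N -> u k = 0) -> limn (series u) = \sum_(k < N) u k.
Proof.
move=> u0; apply: lim_near_cst => //; exists N => // n /= Nn.
rewrite seriesEnat /= (big_cat_nat _ (n := N)) //= big_mkord.
rewrite [X in _ + X]big_nat_cond [X in _ + X]big1 ?addr0 //.
by move=> i /andP[/andP[/u0]].
Qed.

(** The ratio bound makes [(1 - r) * \sum_(N <= k < n) u k + u n] nonincreasing in
    [n], hence bounded by its value [u N] at [N]. *)
Lemma ratio_test (R : realType) (u : nat -> R) (r : R) (N : nat) :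
  r < 1 -> (forall k, 0 <= u k) ->
  (forall k, (N <= k)%N -> u k.+1 <= r * u k) -> cvgn (series u).
Proof.
move=> r1 u0 ur; rewrite -(is_cvg_series_restrict N).
have bnd n : (N <= n)%N -> (1 - r) * \sum_(N <= k < n) u k + u n <= u N.
  elim: n => [|n IH]; first by rewrite leqn0 => /eqP->; rewrite big_geq // mulr0 add0r.
  rewrite leq_eqVlt => /predU1P[->|Nn]; first by rewrite big_geq // mulr0 add0r.
  apply: le_trans (IH Nn); rewrite big_nat_recr //=.
  by have := ur _ Nn; lra.
apply: nondecreasing_is_cvgn.
  apply/nondecreasing_seqP => n /=.
  have [Nn|nN] := leqP N n; first by rewrite big_nat_recr //= lerDl.
  by rewrite !big_geq // ltnW.
exists (u N / (1 - r)) => _ [n _ <-] /=; rewrite ler_pdivlMr ?subr_gt0 // mulrC.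
have [/bnd|nN] := leqP N n; first by have := u0 n; lra.
by rewrite big_geq ?mulr0 // ltnW.
Qed.

(** * Binomial probabilities *)

(** [binprob y q l k] is the probability of [k] successes in [l] trials when
    [q = 1 - y]; the recurrences hold for independent [y] and [q]. *)
Definition binprob {R : pzRingType} (y q : R) (l k : nat) : R :=
  'C(l, k)%:R * y ^+ k * q ^+ (l - k).

Lemma binprob_small (R : pzRingType) (y q : R) (l k : nat) :
  (l < k)%N -> binprob y q l k = 0.
Proof. by move=> lk; rewrite /binprob bin_small // !mul0r. Qed.

Lemma binprob_ge0 (R : numDomainType) (y q : R) (l k : nat) :
  0 <= y -> 0 <= q -> 0 <= binprob y q l k.
Proof. by move=> y0 q0; rewrite !mulr_ge0 ?exprn_ge0. Qed.

Lemma binprobS0 (R : comPzRingType) (y q : R) (l : nat) :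
  binprob y q l.+1 0 = q * binprob y q l 0.
Proof. by rewrite /binprob !bin0 !subn0 exprS; ring. Qed.

(** Pascal's rule: the last trial is a success or a failure. *)
Lemma binprobS (R : comPzRingType) (y q : R) (l k : nat) :
  binprob y q l.+1 k.+1 = y * binprob y q l k + q * binprob y q l k.+1.
Proof.
rewrite /binprob binS natrD subSS [y ^+ k.+1]exprS.
have [lk|kl] := leqP l k; first by rewrite [in 'C(l, k.+1)]bin_small //; ring.
by rewrite -(subnSK kl) exprS; ring.
Qed.

(** Squaring [binprobS] and dropping the cross terms [2 * y * q * b l k * b l k.+1]
    leaves one copy of the sum of squares for each outcome of the last trial. *)
Lemma sum_sqr_binprobS (R : numDomainType) (y q : R) (l : nat) :
  0 <= y -> 0 <= q ->
  (y ^+ 2 + q ^+ 2) * \sum_(k < l.+1) binprob y q l k ^+ 2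
    <= \sum_(k < l.+2) binprob y q l.+1 k ^+ 2.
Proof.
move=> y0 q0; rewrite mulrDl.
(* For a failure of the last trial the summation index is shifted back, and the
   sum extended to [l.+1] successes in [l] trials, whose probability is 0. *)
have -> : q ^+ 2 * \sum_(k < l.+1) binprob y q l k ^+ 2 =
          (q * binprob y q l 0) ^+ 2 + \sum_(k < l.+1) (q * binprob y q l k.+1) ^+ 2.
  transitivity (\sum_(k < l.+2) (q * binprob y q l k) ^+ 2); last first.
    by rewrite big_ord_recl.
  rewrite [RHS]big_ord_recr /= binprob_small // mulr0 expr0n addr0 mulr_sumr.
  by apply: eq_bigr => k _; rewrite -exprMn.
rewrite [leRHS]big_ord_recl /= binprobS0 addrCA lerD2l mulr_sumr -big_split /=.
apply: ler_sum => k _; rewrite [bump _ _]/= binprobS -exprMn sqrrD lerD2r lerDl.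
by apply/mulrn_wge0/mulr_ge0; apply: mulr_ge0 => //; exact: binprob_ge0.
Qed.

(** * Generalized binomial coefficients *)

Lemma gbinomS (R : realType) (a : R) (k : nat) :
  gbinom a k.+1 = gbinom a k * ((a - k%:R) / k.+1%:R).
Proof. by rewrite /gbinom big_ord_recr /= factS natrM invfM; ring. Qed.

Lemma gbinom_natr (R : realType) (l k : nat) :
  gbinom (l%:R : R) k = 'C(l, k)%:R.
Proof.
elim: k => [|k IH]; first by rewrite /gbinom big_ord0 bin0 fact0 divr1.
rewrite gbinomS IH mulrA; apply: (canLR (mulfK _)); first by rewrite pnatr_eq0.
rewrite -natrM [('C(l, k.+1) * _)%N]mulnC mul_bin_left natrM mulrC.
have [kl|lk] := leqP k l; first by rewrite natrB.
by rewrite bin_small // !mulr0.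
Qed.

(** The signs cancel; in this form the coefficient of the negative binomial
    distribution is visibly nonnegative and nondecreasing in [a >= 0]. *)
Lemma gbinomN (R : realType) (a : R) (k : nat) :
  (-1) ^+ k * gbinom (- a) k = (\prod_(i < k) (a + i%:R)) / k`!%:R.
Proof.
rewrite /gbinom mulrA; congr (_ / _).
rewrite -[in (-1) ^+ k](card_ord k) -prodr_const -big_split /=.
by apply: eq_bigr => i _; ring.
Qed.

(** * The case of negative [c] *)

(** At the endpoint [1 + c * x = 0] this relies on [0 ^+ 0 = 1 = 0 `^ 0], and on
    the vanishing of the binomial coefficient wherever the exponent of the real
    power is negative. *)
Lemma pmk_binomial (R : realType) (c x : R) (l k : nat) :
  c != 0 -> 0 <= 1 + c * x ->
  pmk (- c * l%:R) c k x = binprob (- (c * x)) (1 + c * x) l k.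
Proof.
move=> c0 q0; rewrite /pmk /binprob.
have -> : - (- c * l%:R / c) = l%:R by field.
rewrite gbinom_natr; have [kl|lk] := leqP k l.
  rewrite -natrB // powR_mulrn // [(- (c * x)) ^+ k]exprNn; ring.
by rewrite bin_small // mulr0 !mul0r.
Qed.

Lemma S_index_binomial (R : realType) (c x : R) (l : nat) :
  c != 0 -> 0 <= 1 + c * x ->
  S_index (- c * l%:R) c x =
  \sum_(k < l.+1) binprob (- (c * x)) (1 + c * x) l k ^+ 2.
Proof.
move=> c0 q0; rewrite /S_index.
under eq_fun do rewrite pmk_binomial //.
by apply: lim_series_finite => k lk; rewrite binprob_small // expr0n.
Qed.

(** * The case of positive [c] *)

Lemma pmkS (R : realType) (m c x : R) (k : nat) :
  0 < 1 + c * x ->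
  pmk m c k.+1 x =
  c * x / (1 + c * x) * ((m / c + k%:R) / k.+1%:R) * pmk m c k x.
Proof.
move=> q0; rewrite /pmk gbinomS [(-1) ^+ k.+1]exprS [(c * x) ^+ k.+1]exprS.
have -> : - (m / c) - k.+1%:R = - (m / c) - k%:R - 1 by rewrite -natr1; ring.
rewrite (@powRB _ _ (- (m / c) - k%:R) 1) ?(gt_eqF q0) ?implybT // powRr1 ?(ltW q0) //.
ring.
Qed.

(** Passing from [n] to [n - c] replaces [a = n / c] by [a - 1 >= 0]: each factor
    [a + i] of the coefficient decreases, and the exponent of [1 + c * x]
    increases by 1. *)
Lemma pmk_subr_le (R : realType) (n c x : R) (k : nat) :
  0 < c -> c < n -> 0 <= x ->
  0 <= pmk (n - c) c k x <= (1 + c * x) * pmk n c k x.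
Proof.
move=> c0 cn x0.
have t0 : 0 <= c * x by rewrite mulr_ge0 // ltW.
have q0 : 0 < 1 + c * x by rewrite ltr_pwDl.
have a1 : 0 <= n / c - 1 by rewrite subr_ge0 ler_pdivlMr // mul1r ltW.
rewrite /pmk !gbinomN.
have -> : (n - c) / c = n / c - 1 by field; rewrite gt_eqF.
have -> : - (n / c - 1) - k%:R = 1 + (- (n / c) - k%:R) by ring.
rewrite powRD ?(gt_eqF q0) ?implybT // powRr1 ?(ltW q0) // mulrCA.
have coef0 : 0 <= (\prod_(i < k) (n / c - 1 + i%:R)) / k`!%:R.
  by rewrite divr_ge0 // prodr_ge0 // => i _; rewrite addr_ge0.
have pw0 := powR_ge0 (1 + c * x) (- (n / c) - k%:R).
have tk0 : 0 <= (c * x) ^+ k by rewrite exprn_ge0.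
have q0w := ltW q0; apply/andP; split.
  by apply: mulr_ge0 => //; apply: mulr_ge0 => //; apply: mulr_ge0.
rewrite ler_pM2l // !ler_wpM2r ?invr_ge0 //.
by apply: ler_prod => i _; rewrite addr_ge0 //= lerD2r gerBl.
Qed.

(** The ratio of successive probabilities given by [pmkS] tends to
    [z = c * x / (1 + c * x) < 1], so it is eventually below the midpoint [s] of
    [z] and [1]; the squares then satisfy the ratio test with [s ^+ 2]. *)
Lemma is_cvg_series_sqr_pmk (R : realType) (m c x : R) :
  0 < c -> 0 <= m -> 0 <= x -> cvgn (series (fun k => pmk m c k x ^+ 2)).
Proof.
move=> c0 m0 x0.
have t0 : 0 <= c * x by rewrite mulr_ge0 // ltW.
have q0 : 0 < 1 + c * x by rewrite ltr_pwDl.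
set z := c * x / (1 + c * x).
have z0 : 0 <= z by rewrite divr_ge0 // ltW.
have z1 : z < 1 by rewrite ltr_pdivrMr // mul1r ltrDr.
have a0 : 0 <= m / c by rewrite divr_ge0 // ltW.
pose s := (1 + z) / 2.
have s0 : 0 <= s by rewrite /s; lra.
have s1 : s < 1 by rewrite /s; lra.
(* [z * (m / c + k) <= s * k] amounts to [z * (m / c) / (s - z) <= k]. *)
pose N := (Num.truncn (z * (m / c) / (s - z))).+1.
apply: (@ratio_test _ _ (s ^+ 2) N).
- by rewrite expr_lt1.
- by move=> k; rewrite sqr_ge0.
move=> k Nk; rewrite pmkS // -/z exprMn ler_wpM2r ?sqr_ge0 //.
have sz : 0 < s - z by rewrite /s; lra.
have {}Nk : z * (m / c) <= k%:R * (s - z).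
  rewrite -ler_pdivrMr //; apply/ltW/(lt_le_trans (truncnS_gt _)).
  by rewrite ler_nat.
rewrite ler_pXn2r ?nnegrE //; last first.
  by apply: mulr_ge0 => //; rewrite divr_ge0 ?addr_ge0.
by rewrite mulrA ler_pdivrMr ?ltr0n // -natr1; lra.
Qed.

(** * The inequalities *)

Theorem theorem6 (R : realType) (c : R) (hc : c != 0) :
  (c < 0 ->
     forall n : R, (exists2 l : nat, (1 <= l)%N & n = - c * l%:R) ->
     forall x : R, x \in `[0, - (1 / c)] ->
       S_index (n - c) c x >= (1 + 2 * c * x * (1 + c * x)) * S_index n c x)
  /\
  (0 < c ->
     forall n : R, c < n ->
     forall x : R, x \in `[0, +oo[ ->
       S_index (n - c) c x <= (1 + 2 * c * x * (1 + c * x)) * S_index n c x).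
Proof.
split=> [c0 n [l _ ->] x|c0 n cn x].
  rewrite in_itv /= => /andP[x0 x1].
  have t0 : 0 <= - (c * x) by rewrite oppr_ge0 mulr_le0_ge0 // ltW.
  have q0 : 0 <= 1 + c * x.
    have := ler_wnM2l (ltW c0) x1.
    have -> : c * - (1 / c) = -1 by field.
    by rewrite -subr_ge0 opprK addrC.
  have -> : - c * l%:R - c = - c * l.+1%:R by rewrite -natr1; ring.
  rewrite !S_index_binomial //; apply: le_trans (sum_sqr_binprobS _ _ _ _ t0 q0).
  rewrite le_eqVlt; apply/orP; left; apply/eqP; congr (_ * _); ring.
rewrite in_itv /= andbT => x0.
have t0 : 0 <= c * x by rewrite mulr_ge0 // ltW.
have cvgS (m : R) : 0 <= m -> cvgn (series (fun k => pmk m c k x ^+ 2)).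
  by move=> m0; apply: is_cvg_series_sqr_pmk.
have cvgSn := cvgS n (ltW (lt_trans c0 cn)).
rewrite /S_index -[leRHS](lim_seriesZ _ cvgSn).
apply: lim_series_le.
- by apply: cvgS; rewrite subr_ge0 ltW.
- exact: is_cvg_seriesZ.
move=> k; have /andP[p0 ple] := pmk_subr_le _ n c x k c0 cn x0.
apply: (@le_trans _ _ (((1 + c * x) * pmk n c k x) ^+ 2)).
  by rewrite ler_pXn2r ?nnegrE // (le_trans p0).
rewrite exprMn ler_wpM2r ?sqr_ge0 // -subr_ge0.
have -> : 1 + 2 * c * x * (1 + c * x) - (1 + c * x) ^+ 2 = (c * x) ^+ 2 by ring.
exact: sqr_ge0.
Qed.
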